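(* Let $F \lhd F_1$ be a finitely generated kernel-preserving strong extension of countable ELA-fields. Then $F_1$ is a finitely presented extension of $F$.
   Context: A partial E-field $F$ is a field of characteristic zero together with a $\mathbb{Q}$-linear subspace $D(F)$ of its additive group and a homomorphism $\exp_F$ from $(D(F),+)$ to the multiplicative group of $F$. Homomorphisms are field embeddings $\theta:F\to F_1$ with $\theta(D(F))\subseteq D(F_1)$ commuting with the exponential maps; extensions are inclusions that are homomorphisms. The kernel of $F$ is $\{x\in D(F):\exp_F(x)=1\}$; an extension is kernel-preserving if the kernels coincide. An ELA-field is a partial E-field with $D(F)=F$ that is algebraically closed and in which every nonzero element is of the form $\exp(a)$. For $X\subseteq F$, $\langle X\rangle_F$ is the partial E-subfield with $D(\langle X\rangle_F)$ the $\mathbb{Q}$-span of $D(F)\cap X$ and underlying field generated by $D(\langle X\rangle_F)\cup\exp_F(D(\langle X\rangle_F))\cup X$. If $F$ is an ELA-field, $\langle X\rangle_F^{ELA}$ is the smallest ELA-subfield of $F$ containing $X$. An extension $F\subseteq F_1$ of ELA-fields is finitely generated if $F_1=\langle F\cup X\rangle_{F_1}^{ELA}$ for some finite $X\subseteq F_1$. For a finite tuple $\bar x$ from $D(F)$ and $B\subseteq D(F)$, $\delta(\bar x/B)=\mathrm{td}(\bar x,\exp(\bar x)/B,\exp(B))-\mathrm{ldim}_{\mathbb{Q}}(\bar x/B)$, where $\mathrm{td}(X/Y)$ is the transcendence degree of $\mathbb{Q}(X,Y)/\mathbb{Q}(Y)$ and $\mathrm{ldim}_{\mathbb{Q}}(X/Y)$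 is the dimension of $\mathrm{span}_{\mathbb Q}(X\cup Y)/\mathrm{span}_{\mathbb Q}(Y)$. An extension $F\subseteq F_1$ is strong, $F\lhd F_1$, if $\delta(\bar x/D(F))\ge0$ for every finite tuple $\bar x$ from $D(F_1)$. If $F$ is a countable ELA-field and $K$ is a finitely generated kernel-preserving partial E-field extension of $F$ (i.e. $K=\langle F\cup X\rangle_K$ with $X$ finite), there is, uniquely up to isomorphism over $K$, a kernel-preserving strong extension $K\lhd L$ with $L$ an ELA-field and $L=\langle K\rangle_L^{ELA}$; it is denoted $K^{ELA}$, the free ELA-field extension of $K$. A finitely generated extension $F\subseteq F_1$ of countable ELA-fields is finitely presented if there is a finite generating tuple $\bar a$ (so $F_1=\langle F\cup\bar a\rangle_{F_1}^{ELA}$) such that, with $K=\langle F\cup\bar a\rangle_{F_1}$, one has $F_1\cong K^{ELA}$ (as extensions of $K$). *)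

(* Defs.v *)
From HB Require Import structures.
From mathcomp Require Import all_boot all_order all_algebra.
From mathcomp Require Import boolp classical_sets functions cardinality.
From mathcomp Require Import mpoly.

Set Implicit Arguments.
Unset Strict Implicit.
Unset Printing Implicit Defensive.

Import GRing.Theory Num.Theory.
Local Open Scope ring_scope.
Local Open Scope classical_set_scope.

Section Subsets.
Variable F : fieldType.
Implicit Types A L U W X Y k : set F.

Definition subfield A : Prop := divring_closed (mem A).

(* [smallest C X] is the intersection of all the A satisfying C that
   contain X. *)
Definition gen_field X : set F := smallest subfield X.

(* Meaningful when F has characteristic 0, so that [ratr] is the embedding of
   the rationals in F. *)
Definition qsubspace A : Prop :=
  A 0 /\ forall (q : rat) x y, A x -> A y -> A (ratr q * x + y).

Definition qspan X : set F := smallest qsubspace X.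

Definition algebraic_over k (x : F) : Prop :=
  exists p : {poly F}, [/\ p != 0, forall i, k p`_i & root p x].

Definition alg_independent k n (t : n.-tuple F) : Prop :=
  forall p : {mpoly F[n]}, (forall m, k (p@_m)) ->
    p.@[tnth t] = 0 -> p = 0.

(* L is a field extension of k with a transcendence basis of n elements. *)
Definition is_trdeg L k n : Prop :=
  exists t : n.-tuple F,
    [/\ forall i, L (tnth t i), alg_independent k t &
        forall x, L x -> algebraic_over (gen_field (k `|` [set` t])) x].

(* The quotient space U / W has a basis given by the classes of n elements. *)
Definition is_qdim U W n : Prop :=
  exists t : n.-tuple F,
    [/\ forall i, U (tnth t i),
        forall c : 'I_n -> rat,
          W (\sum_(i < n) ratr (c i) * tnth t i) -> forall i, c i = 0 &
        forall x, U x -> exists c : 'I_n -> rat,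
          W (x - \sum_(i < n) ratr (c i) * tnth t i)].

(* In both cases below, the value is 0 by convention if the degree or dimension
   is infinite; it is always finite if X is finite. *)
Definition td X Y : nat :=
  xget 0%N [set n | is_trdeg (gen_field (X `|` Y)) (gen_field Y) n].

Definition ldim X Y : nat :=
  xget 0%N [set n | is_qdim (qspan (X `|` Y)) (qspan Y) n].

End Subsets.

(* The exponential map is represented by a total function
   whose values outside of its domain are irrelevant. *)
Record pEfield := PEField {
  pe_field :> fieldType;
  pe_char0 : [pchar pe_field] =i pred0;
  pe_dom : set pe_field;
  pe_exp : pe_field -> pe_field;
  pe_dom_qsubspace : qsubspace pe_dom;
  pe_exp_neq0 : forall x, pe_dom x -> pe_exp x != 0;
  pe_expD : forall x y, pe_dom x -> pe_dom y ->
    pe_exp (x + y) = pe_exp x * pe_exp y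
}.

Arguments pe_dom : clear implicits.

Definition kernel (F : pEfield) : set F :=
  [set x | pe_dom F x /\ pe_exp x = 1].

Arguments kernel : clear implicits.

(* Homomorphisms of partial E-fields; an extension is represented by the
   corresponding homomorphism, which is necessarily injective. *)
Record pEhom (F F1 : pEfield) := PEHom {
  pe_hom :> {rmorphism F -> F1};
  pe_hom_dom : forall x, pe_dom F x -> pe_dom F1 (pe_hom x);
  pe_hom_exp : forall x, pe_dom F x -> pe_exp (pe_hom x) = pe_hom (pe_exp x)
}.

Definition kernel_preserving (F F1 : pEfield) (i : pEhom F F1) : Prop :=
  kernel F1 = i @` kernel F.

Definition delta (F : pEfield) (x : seq F) (B : set F) : int :=
  (td ([set` x] `|` @pe_exp F @` [set` x]) (B `|` @pe_exp F @` B))%:Z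
  - (ldim [set` x] B)%:Z.

Definition strong (F F1 : pEfield) (i : pEhom F F1) : Prop :=
  forall x : seq F1, [set` x] `<=` pe_dom F1 ->
    0 <= delta x (i @` pe_dom F).

Definition is_ELA (F : pEfield) : Prop :=
  [/\ pe_dom F = setT, GRing.closed_field_axiom F &
      forall y : F, y != 0 -> exists a : F, pe_exp a = y].

Record subpE (F : pEfield) := SubPE {
  sp_set : set F;
  sp_dom : set F;
  sp_subfield : subfield sp_set;
  sp_qsubspace : qsubspace sp_dom;
  sp_dom_sub : sp_dom `<=` sp_set;
  sp_dom_pe : sp_dom `<=` pe_dom F;
  sp_exp : forall x, sp_dom x -> sp_set (pe_exp x)
}.

(* A partial E-subfield, as a partial E-field in its own right. *)
Section SubPEField.
Variables (F : pEfield) (A : subpE F).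

Definition sp_pred : {pred F} := fun x => x \in sp_set A.

Lemma sp_pred_divring : divring_closed sp_pred.
Proof. exact: sp_subfield. Qed.

HB.instance Definition _ :=
  GRing.isDivringClosed.Build F sp_pred sp_pred_divring.

Definition sp_type := {x : F | sp_pred x}.

HB.instance Definition _ := SubChoice.on sp_type.
HB.instance Definition _ := [SubChoice_isSubComUnitRing of sp_type by <:].
HB.instance Definition _ := [SubComUnitRing_isSubIntegralDomain of sp_type by <:].
HB.instance Definition _ := [SubIntegralDomain_isSubField of sp_type by <:].

Definition sp_val : {rmorphism sp_type -> F} := val.

Definition sp_pe_dom : set sp_type := [set x | sp_dom A (sp_val x)].

Definition sp_pe_exp (x : sp_type) : sp_type := insubd 1 (pe_exp (sp_val x)).

Lemma sp_pe_expE x : sp_pe_dom x -> sp_val (sp_pe_exp x) = pe_exp (sp_val x).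
Proof.
by move=> Dx; rewrite /sp_val /sp_pe_exp /= insubdK //; apply/mem_set/sp_exp.
Qed.

Lemma sp_char0 : [pchar sp_type] =i pred0.
Proof. by move=> p; rewrite -(fmorph_pchar sp_val) pe_char0. Qed.

Lemma sp_pe_dom_qsubspace : qsubspace sp_pe_dom.
Proof.
have [D0 DD] := sp_qsubspace A; split=> [|q x y Dx Dy]; rewrite /sp_pe_dom /mkset.
  by rewrite rmorph0.
by rewrite rmorphD rmorphM fmorph_rat; apply: DD.
Qed.

Lemma sp_pe_exp_neq0 x : sp_pe_dom x -> sp_pe_exp x != 0.
Proof.
move=> Dx; rewrite -(fmorph_eq0 sp_val) sp_pe_expE //.
by apply/pe_exp_neq0/(@sp_dom_pe _ A).
Qed.

Lemma sp_pe_expD x y : sp_pe_dom x -> sp_pe_dom y ->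
  sp_pe_exp (x + y) = sp_pe_exp x * sp_pe_exp y.
Proof.
move=> Dx Dy; have Dxy : sp_pe_dom (x + y).
  have [_ /(_ 1 _ _ Dx Dy)] := sp_pe_dom_qsubspace.
  by rewrite (ratr_nat _ 1) mul1r.
apply: (fmorph_inj sp_val); rewrite rmorphM !sp_pe_expE // rmorphD.
by apply: pe_expD; apply: (@sp_dom_pe _ A).
Qed.

Definition sub_pEfield : pEfield :=
  PEField sp_char0 sp_pe_dom_qsubspace sp_pe_exp_neq0 sp_pe_expD.

Definition sub_incl : pEhom sub_pEfield F :=
  @PEHom sub_pEfield F sp_val (fun x Dx => sp_dom_pe Dx)
    (fun x Dx => esym (sp_pe_expE Dx)).

End SubPEField.

(* The partial E-subfield generated by X. *)
Section Generated.
Variables (F : pEfield) (X : set F).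

Definition pe_gen_dom : set F := qspan (pe_dom F `&` X).

Definition pe_gen_set : set F :=
  gen_field (pe_gen_dom `|` @pe_exp F @` pe_gen_dom `|` X).

Lemma pe_gen_subfield : subfield pe_gen_set.
Proof.
split=> [|x y /set_mem Sx /set_mem Sy|x y /set_mem Sx /set_mem Sy];
  apply/mem_set => B SB; have [[B1 BB BV] _] := SB; apply: set_mem => //.
- by apply: BB; apply/mem_set; [apply: Sx | apply: Sy].
- by apply: BV; apply/mem_set; [apply: Sx | apply: Sy].
Qed.

Lemma pe_gen_qsubspace : qsubspace pe_gen_dom.
Proof.
split=> [B [[]] //|q x y Dx Dy B SB]; have [[B0 BD] _] := SB.
by apply: BD; [apply: Dx | apply: Dy].
Qed.

Lemma pe_gen_dom_sub : pe_gen_dom `<=` pe_gen_set.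
Proof. by move=> x Dx; apply: sub_gen_smallest; left; left. Qed.

Lemma pe_gen_dom_pe : pe_gen_dom `<=` pe_dom F.
Proof.
move=> x; apply; split; first exact: pe_dom_qsubspace.
by move=> y [].
Qed.

Lemma pe_gen_exp x : pe_gen_dom x -> pe_gen_set (pe_exp x).
Proof. by move=> Dx; apply: sub_gen_smallest; left; right; exists x. Qed.

Definition pe_gen : subpE F :=
  SubPE pe_gen_subfield pe_gen_qsubspace pe_gen_dom_sub pe_gen_dom_pe
    pe_gen_exp.

End Generated.

Definition ELA_subfield (F : pEfield) (A : set F) : Prop :=
  exists2 S : subpE F, sp_set S = A & is_ELA (sub_pEfield S).

(* As logarithms are only determined up to the kernel, this intersection need
   not be an ELA-subfield for an arbitrary X. If F is an ELA-field, it is one,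
   hence the smallest one containing X, when X contains the kernel of F or when
   the intersection is F itself. *)
Definition ELA_gen (F : pEfield) (X : set F) : set F :=
  smallest (@ELA_subfield F) X.

Definition finitely_generated (F F1 : pEfield) (i : pEhom F F1) : Prop :=
  exists2 X : set F1, finite_set X & ELA_gen (range i `|` X) = setT.

(* j exhibits L as the free ELA-field extension of K, which is determined up to
   isomorphism over K by these properties. *)
Definition free_ELA_extension (K L : pEfield) (j : pEhom K L) : Prop :=
  [/\ is_ELA L, kernel_preserving j, strong j & ELA_gen (range j) = setT].

Definition isomorphic_over (K L L' : pEfield) (j : pEhom K L) (j' : pEhom K L')
    : Prop :=
  exists (f : pEhom L L') (g : pEhom L' L),
    [/\ cancel f g, cancel g f & forall x, f (j x) = j' x].

(* The free ELA-field extension is only defined for a K that is a finitely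
   generated kernel-preserving extension of F: here the first property holds
   by construction, and the second one is the requirement on h. *)
Definition finitely_presented (F F1 : pEfield) (i : pEhom F F1) : Prop :=
  exists2 a : seq F1, ELA_gen (range i `|` [set` a]) = setT &
    let S := pe_gen (range i `|` [set` a]) in
    let K := sub_pEfield S in
    (exists2 h : pEhom F K, forall x, sub_incl S (h x) = i x &
       kernel_preserving h) /\
    (exists (L : pEfield) (j : pEhom K L),
       free_ELA_extension j /\ isomorphic_over (sub_incl S) j).

(* Main.v *)
(* A transcendence degree and a dimension over the rationals are ranks in
   pregeometries, so they are additive, and hence
   delta(xa / F) = delta(x / Fa) + delta(a / F) for all finite tuples x and a.
   As the extension is strong, the values delta(a / F) are non-negative, and
   some tuple a minimizes delta(a / F) among the finite tuples that contain
   given generators. Then delta(x / Fa) >= 0 for all x, which means that the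
   partial E-field K generated by F and a is strong in F_1. As F_1 is generated
   by K and has the same kernel, it is the free ELA-field extension of K. *)

Require Import Defs.
From HB Require Import structures.
From mathcomp Require Import all_boot all_algebra.
From mathcomp Require Import boolp classical_sets functions cardinality.
From mathcomp Require Import perm mpoly.

Set Implicit Arguments.
Unset Strict Implicit.
Unset Printing Implicit Defensive.

Import GRing.Theory Num.Theory.
Local Open Scope ring_scope.
Local Open Scope classical_set_scope.

(** * Pregeometries *)

Record pregeometry (T : Type) (cl : set T -> set T) : Prop := Pregeometry {
  cl_ext : forall A, A `<=` cl A;
  cl_sub : forall A B, A `<=` cl B -> cl A `<=` cl B;
  cl_exchange : forall A x y, cl (y |` A) x -> ~ cl A x -> cl (x |` A) y
}.

Section Pregeometry.
Variables (T : eqType) (cl : set T -> set T).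
Hypothesis clP : pregeometry cl.
Implicit Types (A B X Y : set T) (s t : seq T).

Lemma cl_mono A B : A `<=` B -> cl A `<=` cl B.
Proof.
by move=> AB; apply: (cl_sub clP); apply: subset_trans AB (cl_ext clP (A := B)).
Qed.

Lemma clU_sub A B X : A `<=` cl X -> B `<=` cl X -> cl (A `|` B) `<=` cl X.
Proof. by move=> AX BX; apply: (cl_sub clP) => x [/AX|/BX]. Qed.

Lemma subset_clUl A B : A `<=` cl (A `|` B).
Proof. by move=> x Ax; apply: (cl_ext clP); left. Qed.

Lemma subset_clUr A B : B `<=` cl (A `|` B).
Proof. by move=> x Bx; apply: (cl_ext clP); right. Qed.

Lemma eq_clU A B X : cl A = cl B -> cl (A `|` X) = cl (B `|` X).
Proof.
suff sub A1 B1 : cl A1 = cl B1 -> cl (A1 `|` X) `<=` cl (B1 `|` X).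
  by move=> eqAB; apply/seteqP; split; apply: sub.
move=> eqAB; apply: clU_sub; last exact: subset_clUr.
apply: subset_trans (@cl_mono B1 _ _); last by move=> x; left.
by rewrite -eqAB; apply: (cl_ext clP).
Qed.

(** Testing each entry against [Y] and the entries before it suits induction on lists and excludes
    repetitions. For [acl] and [qspan] it is matched below with the symmetric definitions. *)
Fixpoint indep Y s : Prop :=
  if s is x :: s' then ~ cl Y x /\ indep (x |` Y) s' else True.

Lemma eq_indep A B s : cl A = cl B -> indep A s -> indep B s.
Proof.
elim: s A B => //= x s IHs A B eqAB [nAx Is].
by split; [rewrite -eqAB | apply: IHs Is; rewrite !(setUC [set x]); apply: eq_clU].
Qed.

Lemma set_cons_setU x s : [set` x :: s] = x |` [set` s].
Proof.
apply/seteqP; split=> y /=; rewrite inE.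
  by case/predU1P=> [->|]; [left | right].
by case=> [->|/= ys]; rewrite ?eqxx // ys orbT.
Qed.

Lemma set_cat_setU s t : [set` s ++ t] = [set` s] `|` [set` t].
Proof.
apply/seteqP; split=> y /=; rewrite mem_cat; first by case/orP; [left | right].
by case=> /= ->; rewrite ?orbT.
Qed.

Lemma indep_cat Y s t :
  indep Y (s ++ t) <-> indep Y s /\ indep (Y `|` [set` s]) t.
Proof.
elim: s Y => [|x s IHs] Y /=; first by rewrite set_nil setU0; tauto.
rewrite IHs set_cons_setU setUA (setUC _ [set x]); tauto.
Qed.

Lemma indep_rcons Y s x :
  indep Y (rcons s x) <-> indep Y s /\ ~ cl (Y `|` [set` s]) x.
Proof. by rewrite -cats1 indep_cat /=; tauto. Qed.

(* Each x in s can replace an element of t: the first one whose addition to a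
   prefix of t puts x in the closure. *)
Lemma indep_size_leq Y s t :
  indep Y s -> [set` s] `<=` cl (Y `|` [set` t]) -> (size s <= size t)%N.
Proof.
elim: s Y t => //= x s IHs Y t [nYx Is] st.
have [t1 [y [t2 [def_t nt1x t1yx]]]] : exists t1 y t2,
    [/\ t = t1 ++ y :: t2, ~ cl (Y `|` [set` t1]) x
      & cl (Y `|` [set` rcons t1 y]) x].
  have: cl (Y `|` [set` t]) x by apply: st; rewrite /= mem_head.
  elim/last_ind: t {st} => [|t y IHt]; first by rewrite set_nil setU0.
  move=> tyx; have [tx|ntx] := pselect (cl (Y `|` [set` t]) x).
    have [t1 [z [t2 [-> ? ?]]]] := IHt tx.
    by exists t1, z, (rcons t2 y); rewrite rcons_cat.
  by exists t, y, [::]; rewrite cats1.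
rewrite def_t size_cat /= addnS ltnS -size_cat; apply: IHs Is _.
have mem_t12 z : z \in t1 ++ t2 -> cl (x |` Y `|` [set` t1 ++ t2]) z.
  by move=> zt; apply: subset_clUr.
(* By exchange over [Y] and [t1], [y] is recovered from [x], so dropping [y] from [t] loses nothing
   once [x] joins the base. *)
have ycl : cl (x |` Y `|` [set` t1 ++ t2]) y.
  have := @cl_exchange _ _ clP (Y `|` [set` t1]) x y.
  rewrite -cats1 set_cat_setU set_cons_setU set_nil setU0 in t1yx.
  rewrite setUA setUC in t1yx => /(_ t1yx nt1x).
  by apply: cl_mono; rewrite set_cat_setU !setUA; left.
have subt : cl (Y `|` [set` t]) `<=` cl (x |` Y `|` [set` t1 ++ t2]).
  apply: clU_sub => z; first by move=> Yz; apply: subset_clUl; right.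
  rewrite /= def_t mem_cat inE => /or3P[z1|/eqP->//|z2];
    by apply: mem_t12; rewrite mem_cat ?z1 ?z2 ?orbT.
by move=> z zs; apply/subt/st; rewrite /= inE zs orbT.
Qed.

(** The basis may lie anywhere in the closure of [Y] and [X], so that bases taken in a generated
    field or a span, as in [is_trdeg] and [is_qdim], qualify. *)
Definition rank_spec Y X n := exists s,
  [/\ size s = n, indep Y s, [set` s] `<=` cl (Y `|` X)
    & X `<=` cl (Y `|` [set` s])].

Lemma rank_uniq Y X m n : rank_spec Y X m -> rank_spec Y X n -> m = n.
Proof.
suff leq k l : rank_spec Y X k -> rank_spec Y X l -> (k <= l)%N.
  by move=> Xm Xn; apply/eqP; rewrite eqn_leq !leq.
move=> [s [<- Is sX _]] [t [<- _ _ Xt]]; apply: indep_size_leq Is _.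
apply: subset_trans sX _; apply: clU_sub Xt; exact: subset_clUl.
Qed.

Lemma basis_exists Y s : exists t,
  [/\ indep Y t, [set` t] `<=` [set` s] & [set` s] `<=` cl (Y `|` [set` t])].
Proof.
elim: s Y => [|x s IHs] Y; first by exists [::]; split=> // z; rewrite set_nil.
have [Yx|nYx] := pselect (cl Y x).
  have [t [It ts st]] := IHs Y; exists t; split=> // z.
    by move/ts; rewrite /= inE => ->; rewrite orbT.
  rewrite /= inE => /predU1P[->|]; last exact: st.
  by apply: cl_mono Yx => ?; left.
have [t [It ts st]] := IHs (x |` Y); exists (x :: t).
split=> //; rewrite !set_cons_setU ?setUA ?(setUC Y); first exact: setUS.
by move=> z [->|/st //]; apply: (cl_ext clP); left; left.
Qed.

(** A basis of [A] over [Y] followed by a basis of [X] over [Y] and [A] is a basis of their union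
    over [Y]. *)
Lemma rank_add Y A X m n :
  rank_spec Y A m -> rank_spec (Y `|` A) X n ->
  rank_spec Y (X `|` A) (n + m).
Proof.
move=> [s [<- Is sA As]] [t [<- It tX Xt]]; exists (s ++ t).
have eqYs : cl (Y `|` A) = cl (Y `|` [set` s]).
  by apply/seteqP; split; apply: clU_sub; rewrite //; apply: subset_clUl.
split; first by rewrite size_cat addnC.
- by apply/indep_cat; split=> //; apply: eq_indep It.
- rewrite set_cat_setU => z [/sA|/tX]; first by apply: cl_mono; rewrite setUA setUAC; left.
  by rewrite -setUA (setUC A).
- rewrite set_cat_setU setUA => z [/Xt|/As]; first by rewrite (eq_clU _ eqYs).
  by apply: cl_mono => y; left.
Qed.

Lemma eq_rank A B X n : cl A = cl B -> rank_spec A X n -> rank_spec B X n.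
Proof.
move=> eqAB [s [sn Is sX Xs]]; exists s; split=> //; first exact: eq_indep Is.
  by rewrite -(eq_clU _ eqAB).
by rewrite -(eq_clU _ eqAB).
Qed.

End Pregeometry.

(** * Algebraic closure *)

Section Subfield.
Variables (F : fieldType) (A : set F).
Hypothesis SA : subfield A.

(** The proof of [subfield A] is an argument so that the algebraic structures declared below can be
    inferred from the predicate alone. *)
Definition sf_pred of subfield A : {pred F} := fun x => x \in A.

Lemma sf_predP x : reflect (A x) (x \in sf_pred SA).
Proof. by apply: (iffP idP) => [/set_mem|/mem_set]. Qed.

Lemma sf_pred_divring : divring_closed (sf_pred SA).
Proof. exact: SA. Qed.

HB.instance Definition _ :=
  GRing.isDivringClosed.Build F (sf_pred SA) sf_pred_divring.

Definition sf_type := {x : F | sf_pred SA x}.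

HB.instance Definition _ := SubChoice.on sf_type.
HB.instance Definition _ := [SubChoice_isSubComUnitRing of sf_type by <:].
HB.instance Definition _ := [SubComUnitRing_isSubIntegralDomain of sf_type by <:].
HB.instance Definition _ := [SubIntegralDomain_isSubField of sf_type by <:].

Definition sf_val : {rmorphism sf_type -> F} := val.

(** Turning the subfield into a type gives access to the theory of [algebraicOver] and
    [integralOver] along a morphism. *)
Lemma algebraic_over_sf_val x :
  algebraic_over A x <-> algebraicOver sf_val x.
Proof.
split=> [[p [p0 Ap px]]|[p p0 px]].
  have [q def_p] : exists q, p = map_poly sf_val q.
    exists (\poly_(i < size p) insubd 0 p`_i); apply/polyP=> i.
    rewrite coef_map coef_poly; case: ltnP => [_|/leq_sizeP-> //].
    by symmetry; apply: insubdK; apply/mem_set/Ap.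
  by exists q; rewrite -?def_p // -(map_poly_eq0 sf_val) -def_p.
exists (map_poly sf_val p); split; rewrite ?map_poly_eq0 // => i.
by rewrite coef_map; apply/set_mem/(valP p`_i).
Qed.

Lemma algebraic_over_subfield : subfield (algebraic_over A).
Proof.
split=> [|x y|x y]; rewrite !inE !algebraic_over_sf_val.
- exact: algebraic1.
- exact: algebraic_sub.
- exact: algebraic_div.
Qed.

(** Transitivity of algebraicity, obtained from integrality, which is the same notion over a
    field. *)
Lemma algebraic_over_root (p : {poly F}) x : p != 0 ->
  (forall i, algebraic_over A p`_i) -> root p x -> algebraic_over A x.
Proof.
move=> p0 Ap px; apply/algebraic_over_sf_val/integral_algebraic.
apply: integral_root p0 px _; apply/integral_poly => i.
by apply/integral_algebraic/algebraic_over_sf_val.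
Qed.

Lemma subfield_algebraic : A `<=` algebraic_over A.
Proof.
move=> x Ax; apply/algebraic_over_sf_val.
exact: (algebraic_id sf_val (exist _ x (mem_set Ax))).
Qed.

End Subfield.

Section GenField.
Variable F : fieldType.
Implicit Types (A B X : set F).

Lemma gen_field_subfield X : subfield (gen_field X).
Proof.
split=> [|x y /set_mem Sx /set_mem Sy|x y /set_mem Sx /set_mem Sy];
  apply/mem_set => B SB; have [[B1 BB BV] _] := SB; apply: set_mem => //.
- by apply: BB; apply/mem_set; [apply: Sx | apply: Sy].
- by apply: BV; apply/mem_set; [apply: Sx | apply: Sy].
Qed.

Lemma sub_gen_field X : X `<=` gen_field X.
Proof. exact: sub_gen_smallest. Qed.

Lemma gen_field_sub A X : subfield A -> X `<=` A -> gen_field X `<=` A.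
Proof. exact: smallest_sub. Qed.

Lemma gen_field_mono A B : A `<=` B -> gen_field A `<=` gen_field B.
Proof.
move=> AB; apply: gen_field_sub (gen_field_subfield B) _.
by move=> x /AB; apply: sub_gen_field.
Qed.

Lemma gen_field_genU A B : gen_field (gen_field A `|` B) = gen_field (A `|` B).
Proof.
apply/seteqP; split; last first.
  by apply: gen_field_mono; apply: setSU; apply: sub_gen_field.
apply: gen_field_sub (gen_field_subfield _) _ => x [|Bx].
  by apply: gen_field_mono; left.
by apply: sub_gen_field; right.
Qed.

Lemma gen_field_gen A : gen_field (gen_field A) = gen_field A.
Proof. by have := gen_field_genU A set0; rewrite !setU0. Qed.

(** The relative algebraic closure in [F] of the field generated by [A]. *)
Definition acl A : set F := algebraic_over (gen_field A).

Lemma acl_subfield A : subfield (acl A).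
Proof. exact: algebraic_over_subfield (gen_field_subfield A). Qed.

Lemma gen_field_sub_acl A : gen_field A `<=` acl A.
Proof. exact: subfield_algebraic (gen_field_subfield A). Qed.

Lemma sub_acl A : A `<=` acl A.
Proof. by move=> x Ax; exact: (gen_field_sub_acl (sub_gen_field Ax)). Qed.

Lemma acl_root A (p : {poly F}) x : p != 0 ->
  (forall i, acl A p`_i) -> root p x -> acl A x.
Proof. exact: algebraic_over_root (gen_field_subfield A) _ _. Qed.

Lemma acl_sub A B : A `<=` acl B -> acl A `<=` acl B.
Proof.
move=> AB x [p [p0 Ap px]]; apply: acl_root p0 _ px => i.
by apply: gen_field_sub (Ap i) => //; apply: acl_subfield.
Qed.

Lemma acl_genU A B : acl (gen_field A `|` B) = acl (A `|` B).
Proof. by rewrite /acl gen_field_genU. Qed.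

Lemma acl_gen A : acl (gen_field A) = acl A.
Proof. by rewrite /acl gen_field_gen. Qed.

End GenField.

(** * Algebraic independence *)

Section MPoly.
Variable R : nzRingType.

Definition mnm_rcons n (m : 'X_{1..n}) i : 'X_{1..n.+1} := [multinom of rcons m i].

Definition mnm_belast n (m : 'X_{1..n.+1}) : 'X_{1..n} :=
  [multinom m (widen_ord (leqnSn n) i) | i < n].

Lemma mnm_belast_rcons n (m : 'X_{1..n}) i : mnm_belast (mnm_rcons m i) = m.
Proof.
apply/mnmP => j; rewrite mnmE multinomE (tnth_nth 0%N) /= nth_rcons size_tuple.
by rewrite ltn_ord -tnth_nth.
Qed.

Lemma mnm_rcons_max n (m : 'X_{1..n}) i : mnm_rcons m i ord_max = i.
Proof.
by rewrite multinomE (tnth_nth 0%N) /= nth_rcons size_tuple ltnn eqxx.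
Qed.

Lemma mnm_rcons_belast n (m : 'X_{1..n.+1}) :
  mnm_rcons (mnm_belast m) (m ord_max) = m.
Proof.
apply/mnmP => i; have [lt_in|ge_in] := ltnP i n; last first.
  have -> : i = ord_max by apply/val_inj/eqP; rewrite eqn_leq ge_in -ltnS ltn_ord.
  exact: mnm_rcons_max.
have -> : i = widen_ord (leqnSn n) (Ordinal lt_in) by apply: val_inj.
have := congr1 (fun m : 'X_{1..n} => m (Ordinal lt_in))
  (mnm_belast_rcons (mnm_belast m) (m ord_max)).
by rewrite {1}mnmE => ->; rewrite mnmE.
Qed.

(** [muni] singles out the last variable, so a monomial splits into its first exponents and its last
    one. This makes [muni] a bijection, which allows induction on the length of a tuple. *)
Lemma mcoeff_muni n (p : {mpoly R[n.+1]}) i m :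
  (muni p)`_i@_m = p@_(mnm_rcons m i).
Proof.
rewrite muniE coef_sum raddf_sum [in RHS](mpolyE p) raddf_sum /=.
apply: eq_bigr => m' _; rewrite coefZ coefXn mcoeffZ mcoeffX.
have -> : (m' == mnm_rcons m i) = (mnm_belast m' == m) && (i == m' ord_max).
  apply/eqP/andP => [->|[/eqP<- /eqP->]]; last by rewrite mnm_rcons_belast.
  by rewrite mnm_belast_rcons mnm_rcons_max.
case: (i == _); rewrite ?andbF ?mulr0 ?mcoeff0 // andbT mulr1.
by rewrite mcoeffZ mcoeffX.
Qed.

Lemma muni_inj n : injective (@muni n R).
Proof.
move=> p q eq_pq; apply/mpolyP => m.
by rewrite -(mnm_rcons_belast m) -!mcoeff_muni eq_pq.
Qed.

Lemma muniX_rcons n (m : 'X_{1..n}) i :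
  muni 'X_[mnm_rcons m i] = 'X_[m] *: 'X^i :> {poly {mpoly R[n]}}.
Proof.
rewrite muniE msuppX big_seq1 mcoeffX eqxx scale1r mnm_rcons_max.
by rewrite -[X in 'X_[X]]/(mnm_belast _) mnm_belast_rcons.
Qed.

Lemma muni_surj n (q : {poly {mpoly R[n]}}) : exists p, muni p = q.
Proof.
exists (\sum_(i < size q) \sum_(m <- msupp q`_i)
  q`_i@_m *: 'X_[mnm_rcons m i]).
rewrite raddf_sum -[RHS]coefK poly_def; apply: eq_bigr => i _ /=.
rewrite raddf_sum [in RHS](mpolyE q`_i) scaler_suml; apply: eq_bigr => m _ /=.
by rewrite muniZ muniX_rcons scalerA mul_mpolyC.
Qed.

End MPoly.

Lemma meval_muni (R : comNzRingType) n (p : {mpoly R[n.+1]}) v :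
  p.@[v] =
  (map_poly (meval (v \o widen_ord (leqnSn n))) (muni p)).[v ord_max].
Proof.
rewrite muniE raddf_sum horner_sum mevalE; apply: eq_bigr => m _ /=.
rewrite map_polyZ map_polyXn /= hornerZ hornerXn mevalZ mevalX big_ord_recr /=.
by rewrite mulrA; under [in RHS]eq_bigr do rewrite mnmE.
Qed.

Lemma meval_msym (R : comNzRingType) n (s : 'S_n) (p : {mpoly R[n]}) v :
  (msym s p).@[v] = p.@[v \o s].
Proof.
rewrite /msym /mmap raddf_sum mevalE; apply: eq_bigr => m _ /=.
rewrite mevalM mevalC /mmap1 rmorph_prod; congr (_ * _).
by apply: eq_bigr => i _; rewrite rmorphXn /= mevalXU.
Qed.

(** The length is part of the type of a tuple, and equal lists may come with lengths that are only
    provably equal. *)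
Lemma alg_independent_cast (F : fieldType) (k : set F) m n (t : m.-tuple F)
    (u : n.-tuple F) :
  t = u :> seq F -> alg_independent k t -> alg_independent k u.
Proof.
move=> eq_tu; have eq_mn : m = n by rewrite -(size_tuple t) eq_tu size_tuple.
by case: n / eq_mn u eq_tu => u /val_inj->.
Qed.

Lemma alg_independent_nil (F : fieldType) (k : set F) (t : 0.-tuple F) :
  alg_independent k t.
Proof.
move=> p _; have -> : p = (p@_0)%:MP.
  apply/mpolyP => m; have -> : m = 0%MM by apply/mnmP; case.
  by rewrite mcoeffC eqxx mulr1.
by rewrite mevalC => ->; rewrite raddf0.
Qed.

Section AlgIndependent.
Variables (F : fieldType) (k : set F).
Hypothesis Sk : subfield k.

Lemma mpoly_overP n (p : {mpoly F[n]}) :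
  p \is a mpolyOver n (sf_pred Sk) <-> forall m, k p@_m.
Proof.
split=> [/mpolyOverP kp m|kp]; first exact/sf_predP/kp.
by apply/mpolyOverP => m; apply/sf_predP/kp.
Qed.

(** The quotients of values at [t] of polynomials over [k] form a subfield that contains [k] and
    [t]. *)
Lemma gen_field_frac n (t : n.-tuple F) x : gen_field (k `|` [set` t]) x ->
  exists p d : {mpoly F[n]},
    [/\ p \is a mpolyOver n (sf_pred Sk), d \is a mpolyOver n (sf_pred Sk),
        d.@[tnth t] != 0 & x = p.@[tnth t] / d.@[tnth t]].
Proof.
move: x; apply: gen_field_sub.
  split=> [|x y|x y]; rewrite !inE.
  - by exists 1, 1; rewrite rpred1 meval1 oner_eq0 divr1.
  - move=> [p [d [kp kd d0 ->]]] [q [e [kq ke e0 ->]]].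
    exists (p * e - q * d), (d * e).
    by rewrite rpredB ?rpredM // mevalB !mevalM mulf_neq0 // -mulNr addf_div // mulNr.
  - move=> [p [d [kp kd d0 ->]]] [q [e [kq ke e0 ->]]].
    (* Division by zero gives zero, which is the fraction 0 / 1. *)
    have [q0|q0] := eqVneq q.@[tnth t] 0.
      by exists 0, 1; rewrite rpred0 rpred1 meval1 oner_eq0 meval0 q0 !mul0r invr0 mulr0.
    exists (p * e), (d * q); rewrite !rpredM // !mevalM mulf_neq0 //.
    by split=> //; rewrite invf_div mulf_div.
move=> x [kx|/= /tnthP[i ->]].
  exists x%:MP, 1; rewrite mpolyOverC rpred1 mevalC meval1 oner_eq0 divr1.
  by split=> //; apply/sf_predP.
exists 'X_i, 1; rewrite mpolyOverX rpred1 mevalXU meval1 oner_eq0 divr1.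
by split.
Qed.

Lemma gen_field_meval n (t : n.-tuple F) (p : {mpoly F[n]}) :
  (forall m, k p@_m) -> gen_field (k `|` [set` t]) p.@[tnth t].
Proof.
move=> kp; have Sg := gen_field_subfield (k `|` [set` t]).
suff: p.@[tnth t] \in sf_pred Sg by move/sf_predP.
rewrite mevalE; apply: rpred_sum => m _.
apply: rpredM; first by apply/sf_predP; apply: sub_gen_field; left.
apply: rpred_prod => i _; apply/rpredX/sf_predP.
by apply: sub_gen_field; right; apply: mem_tnth.
Qed.

Lemma clear_denominators n (t : n.-tuple F) (q : {poly F}) :
    (forall i, gen_field (k `|` [set` t]) q`_i) ->
  exists (d : {mpoly F[n]}) (Q : {poly {mpoly F[n]}}),
    [/\ d \is a mpolyOver n (sf_pred Sk), d.@[tnth t] != 0,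
        forall i, Q`_i \is a mpolyOver n (sf_pred Sk)
      & map_poly (meval (tnth t)) Q = d.@[tnth t] *: q].
Proof.
elim/poly_ind: q => [|q c IHq] kq.
  exists 1, 0; rewrite rpred1 meval1 oner_eq0 raddf0 scaler0.
  by split=> // i; rewrite coef0 rpred0.
have [|d [Q [kd d0 kQ eqQ]]] := IHq.
  by move=> i; have := kq i.+1; rewrite coefD coefMX coefC /= addr0.
have [p [e [kp ke e0 def_c]]] : exists p d : {mpoly F[n]},
    [/\ p \is a mpolyOver n (sf_pred Sk), d \is a mpolyOver n (sf_pred Sk),
        d.@[tnth t] != 0 & c = p.@[tnth t] / d.@[tnth t]].
  by apply: gen_field_frac; have := kq 0%N; rewrite coefD coefMX coefC /= add0r.
(* The common denominator of the higher coefficients is multiplied by that of the constant term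
   [c]. *)
exists (d * e), (e *: Q * 'X + (d * p)%:P); split.
- exact: rpredM.
- by rewrite mevalM mulf_neq0.
- by move=> i; rewrite coefD coefMX coefC coefZ; case: eqP; rewrite ?add0r ?addr0 rpredM.
rewrite rmorphD rmorphM /= map_polyX map_polyC map_polyZ eqQ scalerA scalerDr.
rewrite -scalerAl !mevalM (mulrC e.@[_]); congr (_ + _).
by rewrite def_c -mul_polyC -polyCM -mulrA (mulrCA e.@[_]) divff // mulr1 /= mevalM.
Qed.

(** Through [muni], a polynomial relation on [t] and [x] is a univariate polynomial with root [x]
    whose coefficients are values at [t]. Conversely, an equation for [x] over the generated field
    becomes such a relation once denominators are cleared. *)
Lemma alg_independent_rcons n (t : n.-tuple F) x :
  alg_independent k [tuple of rcons t x] <->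
  alg_independent k t /\ ~ algebraic_over (gen_field (k `|` [set` t])) x.
Proof.
have eq_widen : tnth [tuple of rcons t x] \o widen_ord (leqnSn n) =1 tnth t.
  by move=> i; rewrite /= !(tnth_nth 0) /= nth_rcons size_tuple ltn_ord.
have eq_max : tnth [tuple of rcons t x] ord_max = x.
  by rewrite (tnth_nth 0) /= nth_rcons size_tuple ltnn eqxx.
have evalE (p : {mpoly F[n.+1]}) : p.@[tnth [tuple of rcons t x]] =
    (map_poly (meval (tnth t)) (muni p)).[x].
  rewrite meval_muni eq_max; congr (_.[x]).
  by apply/polyP => i; rewrite !coef_map; apply: meval_eq.
split=> [It|[It nx] p kp].
  have lift0 (q : {poly {mpoly F[n]}}) : (forall i m, k q`_i@_m) ->
      root (map_poly (meval (tnth t)) q) x -> q = 0.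
    have [p <-] := muni_surj q; move=> kp /eqP px.
    rewrite (It p) ?muni0 // ?evalE // => m.
    by rewrite -(mnm_rcons_belast m) -mcoeff_muni.
  have k0 : k 0 by apply/(sf_predP Sk)/rpred0.
  split=> [p kp p0|[q [q0 kq qx]]].
    apply/eqP; rewrite -polyC_eq0; apply/eqP/lift0 => [i m|].
      by rewrite coefC; case: eqP => // _; rewrite mcoeff0.
    by rewrite map_polyC /= p0 rootC.
  have [d [Q [_ d0 kQ eqQ]]] := clear_denominators kq.
  suff Q0 : Q = 0.
    by move/eqP: eqQ; rewrite Q0 raddf0 eq_sym scaler_eq0 (negPf d0) (negPf q0).
  apply: lift0; last by rewrite eqQ rootZ.
  by move=> i m; apply: (mpoly_overP _).1.
rewrite evalE => px; apply: muni_inj; rewrite muni0.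
apply/polyP => i; rewrite coef0; apply: It => [m|]; first by rewrite mcoeff_muni.
(* If the specialized polynomial is zero, all its coefficients vanish at [t]; otherwise it shows
   that [x] is algebraic. *)
have [q0|q0] := eqVneq (map_poly (meval (tnth t)) (muni p)) 0.
  by have := congr1 (fun q : {poly F} => q`_i) q0; rewrite coef_map coef0.
case: nx; exists (map_poly (meval (tnth t)) (muni p)); split=> // [j|].
  by rewrite coef_map; apply: gen_field_meval => m; rewrite mcoeff_muni.
exact/eqP.
Qed.

(** Permuting the variables of a polynomial permutes the point of evaluation. This symmetry is the
    source of the exchange property of [acl]. *)
Lemma alg_independent_swap x y :
  alg_independent k [tuple x; y] -> alg_independent k [tuple y; x].
Proof.
move=> Ixy p kp pyx; pose s : 'S_2 := tperm ord0 ord_max.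
apply: (@inj_msym 2 F s); rewrite msym0; apply: Ixy => [m|].
  by rewrite mcoeff_sym.
rewrite meval_msym -{}pyx; apply: meval_eq => i /=.
have [->|->] : i = ord0 \/ i = ord_max :> 'I_2.
  by case: i => [[|[|//]] lti]; [left | right]; apply: val_inj.
  by rewrite tpermL.
by rewrite tpermR.
Qed.

Lemma alg_independent_indep (s : seq F) :
  alg_independent k (in_tuple s) <-> indep (@acl F) k s.
Proof.
elim/last_ind: s => [|s x IHs].
  by split=> // _; apply: alg_independent_nil.
rewrite indep_rcons // -IHs -alg_independent_rcons.
by split; apply: alg_independent_cast.
Qed.

End AlgIndependent.

Lemma acl_pregeometry (F : fieldType) : pregeometry (@acl F).
Proof.
split; [exact: sub_acl | exact: acl_sub |] => A x y yAx nAx.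
(* If exchange failed, the pair [x], [y] would be independent over [A], hence also [y], [x],
   contradicting that [x] is algebraic over [A] and [y]. *)
apply: contrapT => nxAy; have Sk := gen_field_subfield A.
have: alg_independent (gen_field A) [tuple x; y].
  suff /(alg_independent_indep Sk) : indep (@acl F) (gen_field A) [:: x; y].
    exact: alg_independent_cast.
  by rewrite /= acl_gen setUC acl_genU setUC.
move/alg_independent_swap => Iyx.
have /(alg_independent_indep Sk) :
  alg_independent (gen_field A) (in_tuple [:: y; x]).
  exact: alg_independent_cast Iyx.
by rewrite /= [y |` _]setUC acl_genU setUC => -[_ []].
Qed.

(** * Linear spans over the rationals *)

Section CharZeroRat.
Variable F : fieldType.
Hypothesis char0 : [pchar F] =i pred0.

Lemma pchar0_intr_eq0 (z : int) : (z%:~R == 0 :> F) = (z == 0).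
Proof.
have natF n : (n%:R == 0 :> F) = (n == 0)%N by move/pcharf0P: char0; apply.
by case: z => n; rewrite ?NegzE ?mulrNz ?oppr_eq0 -pmulrn natF.
Qed.

(** [ratr] uses the reduced fraction; in characteristic 0 every other fraction gives the same value,
    whence additivity and multiplicativity. *)
Lemma pchar0_ratr_frac (m n : int) : n != 0 ->
  ratr (m%:~R / n%:~R) = m%:~R / n%:~R :> F.
Proof.
move=> n0; set q := _ / _.
have dF : (denq q)%:~R != 0 :> F by rewrite pchar0_intr_eq0 denq_eq0.
have nF : n%:~R != 0 :> F by rewrite pchar0_intr_eq0.
apply/eqP; rewrite /ratr eqr_div // -!intrM; apply/eqP; congr _%:~R.
have nQ : n%:~R != 0 :> rat by rewrite intr_eq0.
apply: (@intr_inj rat); rewrite !intrM numqE mulrAC.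
by rewrite /q divfK // mulrC.
Qed.

Lemma pchar0_ratrD (p q : rat) : ratr (p + q) = ratr p + ratr q :> F.
Proof.
rewrite -[p in LHS]divq_num_den -[q in LHS]divq_num_den.
rewrite addf_div ?intr_eq0 ?denq_eq0 // -!intrM -intrD pchar0_ratr_frac.
  by rewrite intrD !intrM -addf_div // pchar0_intr_eq0 denq_eq0.
by rewrite mulf_neq0 ?denq_eq0.
Qed.

Lemma pchar0_ratrM (p q : rat) : ratr (p * q) = ratr p * ratr q :> F.
Proof.
rewrite -[p in LHS]divq_num_den -[q in LHS]divq_num_den.
rewrite mulf_div -!intrM pchar0_ratr_frac; first by rewrite !intrM -mulf_div.
by rewrite mulf_neq0 ?denq_eq0.
Qed.

Lemma pchar0_ratrN (q : rat) : ratr (- q) = - ratr q :> F.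
Proof. by rewrite -mulN1r pchar0_ratrM (ratr_int _ (-1)) mulN1r. Qed.

End CharZeroRat.

Section QSubspace.
Variables (F : fieldType) (A : set F).
Hypothesis QA : qsubspace A.

Lemma qsubspaceD x y : A x -> A y -> A (x + y).
Proof. by move=> Ax Ay; have := QA.2 1 x y Ax Ay; rewrite (ratr_nat _ 1) mul1r. Qed.

Lemma qsubspaceZ q x : A x -> A (ratr q * x).
Proof. by move=> Ax; have := QA.2 q x 0 Ax QA.1; rewrite addr0. Qed.

Lemma qsubspaceN x : A x -> A (- x).
Proof. by move/(qsubspaceZ (-1)); rewrite (ratr_int _ (-1)) mulN1r. Qed.

Lemma qsubspaceB x y : A x -> A y -> A (x - y).
Proof. by move=> Ax /qsubspaceN; apply: qsubspaceD. Qed.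

Lemma qsubspaceMn x n : A x -> A (x *+ n).
Proof. by move/(qsubspaceZ n%:R); rewrite ratr_nat mulr_natl. Qed.

Lemma qsubspace_addr x y : A y -> A (x + y) -> A x.
Proof. by move=> Ay /qsubspaceB /(_ Ay); rewrite addrK. Qed.

End QSubspace.

Lemma subfield_qsubspace (F : fieldType) (A : set F) : subfield A -> qsubspace A.
Proof.
move=> SA; split=> [|q x y /(sf_predP SA) Ax /(sf_predP SA) Ay]; apply/(sf_predP SA).
  exact: rpred0.
by rewrite rpredD // rpredM // rpred_rat.
Qed.

Section QSpan.
Variable F : fieldType.
Implicit Types (A B Y : set F).

Lemma qspan_qsubspace A : qsubspace (qspan A).
Proof.
split=> [B [[]] //|q x y Dx Dy B SB]; have [[B0 BD] _] := SB.
by apply: BD; [apply: Dx | apply: Dy].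
Qed.

Lemma sub_qspan A : A `<=` qspan A.
Proof. exact: sub_gen_smallest. Qed.

Lemma qspan_sub A B : qsubspace B -> A `<=` B -> qspan A `<=` B.
Proof. exact: smallest_sub. Qed.

Lemma qspan_qspan A B : A `<=` qspan B -> qspan A `<=` qspan B.
Proof. exact: qspan_sub (qspan_qsubspace B). Qed.

Lemma qspan_id A : qspan (qspan A) = qspan A.
Proof. by apply/seteqP; split; [apply: qspan_qspan | apply: sub_qspan]. Qed.

Hypothesis char0 : [pchar F] =i pred0.

(** The elements [z] on the right form a rational subspace containing [y] and [A]. *)
Lemma qspan_setU1 A y z :
  qspan (y |` A) z <-> exists q, qspan A (z - ratr q * y).
Proof.
have QA := qspan_qsubspace A; have QyA := qspan_qsubspace (y |` A).
split=> [|[q Az]]; last first.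
  apply: (qsubspace_addr QyA (y := - (ratr q * y))).
    apply: (qsubspaceN QyA); apply: (qsubspaceZ QyA); apply: (@sub_qspan (y |` A)).
    by left.
  by apply: qspan_qspan Az => x Ax; apply: sub_qspan; right.
move: z; apply: qspan_sub; last first.
  move=> x [->|Ax]; last by exists 0; rewrite (ratr_nat _ 0) mul0r subr0; apply: sub_qspan.
  by exists 1; rewrite (ratr_nat _ 1) mul1r subrr; apply: QA.1.
split=> [|q x1 x2 [q1 Ax1] [q2 Ax2]].
  by exists 0; rewrite (ratr_nat _ 0) mul0r subrr; apply: QA.1.
exists (q * q1 + q2); have := QA.2 q _ _ Ax1 Ax2.
by rewrite pchar0_ratrD // pchar0_ratrM // mulrBr mulrDl opprD addrACA mulrA.
Qed.

Lemma qspan_pregeometry : pregeometry (@qspan F).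
Proof.
split; [exact: sub_qspan | exact: qspan_qspan |] => A x y /qspan_setU1[q Ax] nAx.
have [q0|q0] := eqVneq q 0.
  by case: nAx; move: Ax; rewrite q0 (ratr_nat _ 0) mul0r subr0.
(* As [q] is nonzero, the relation between [x] and [y] modulo the span of [A] can be solved for
   [y]. *)
apply/qspan_setU1; exists q^-1.
have := qsubspaceZ (qspan_qsubspace A) (- q^-1) Ax.
rewrite pchar0_ratrN // mulrBr !mulNr mulrA -pchar0_ratrM // mulVf //.
by rewrite (ratr_nat _ 1) mul1r opprK addrC.
Qed.

Lemma qspan_tuple Y n (t : n.-tuple F) z :
  qspan (Y `|` [set` tval t]) z <->
  exists c : 'I_n -> rat, qspan Y (z - \sum_(i < n) ratr (c i) * tnth t i).
Proof.
elim: n Y t z => [|n IHn] Y t z.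
  rewrite tuple0 set_nil setU0; split=> [Yz|[c]]; last by rewrite big_ord0 subr0.
  by exists (fun=> 0); rewrite big_ord0 subr0.
case/tupleP: t => x t /=.
rewrite set_cons_setU setUA (setUC Y) IHn.
split=> [[c /qspan_setU1[q Yz]]|[c Yz]].
  (* The coefficient [q] of the head is put in front of the family [c]. *)
  exists (fun i => oapp c q (unlift ord0 i)); move: Yz.
  rewrite big_ord_recl unlift_none tnth0 opprD addrA addrAC.
  by under [in X in _ -> X]eq_bigr do rewrite liftK tnthS.
exists (c \o lift ord0); apply/qspan_setU1; exists (c ord0); move: Yz.
rewrite big_ord_recl tnth0 opprD addrA addrAC.
by under eq_bigr do rewrite tnthS.
Qed.

Lemma indep_qspan_tuple Y n (t : n.-tuple F) :
  indep (@qspan F) Y t <->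
  forall c : 'I_n -> rat,
    qspan Y (\sum_(i < n) ratr (c i) * tnth t i) -> forall i, c i = 0.
Proof.
elim: n Y t => [|n IHn] Y t; first by rewrite tuple0; split=> // _ c _ [].
have QY := qspan_qsubspace Y.
case/tupleP: t => x t; rewrite /= IHn.
split=> [[nYx Ixt] c|Ixt]; last split=> [Yx|c].
- rewrite big_ord_recl tnth0; under eq_bigr do rewrite tnthS.
  move=> Yc; have c0 i : c (lift ord0 i) = 0.
    (* The term in [x] is absorbed into the base, leaving a relation on [t] alone. Once its
       coefficients vanish, a nonzero coefficient of [x] would put [x] in the span of [Y]. *)
    move: i; apply: Ixt; apply/qspan_setU1; exists (- c ord0).
    by rewrite pchar0_ratrN // mulNr opprK addrC.
  move: Yc; rewrite big1 => [|i _]; last by rewrite c0 (ratr_nat _ 0) mul0r.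
  rewrite addr0 => Yc i; case: (unliftP ord0 i) => [j ->|->]; first exact: c0.
  apply: contra_notP nYx => /eqP nc; have := qsubspaceZ QY (c ord0)^-1 Yc.
  by rewrite mulrA -pchar0_ratrM // mulVf // (ratr_nat _ 1) mul1r.
(* If [x] were in the span of [Y], the coefficients 1 at [x] and 0 elsewhere would form a nontrivial
   relation. *)
- have := Ixt (fun i => oapp (fun=> 0) 1 (unlift ord0 i)) _ ord0.
  rewrite unlift_none /= => /(_ _)/eqP; rewrite oner_eq0 => H.
  suff : false by []; apply: H.
  rewrite big_ord_recl unlift_none tnth0 (ratr_nat _ 1) mul1r big1 ?addr0 // => i _.
  by rewrite liftK /= (ratr_nat _ 0) mul0r.
move=> /qspan_setU1[q Yc] i.
have := Ixt (fun i => oapp c (- q) (unlift ord0 i)) _ (lift ord0 i).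
rewrite liftK; apply; move: Yc; rewrite big_ord_recl unlift_none tnth0 addrC.
rewrite /= pchar0_ratrN // mulNr => Yc.
by under eq_bigr do rewrite liftK tnthS.
Qed.

End QSpan.

(** * Transcendence degree and linear dimension as ranks *)

Section Ranks.
Variable F : fieldType.
Implicit Types (X Y : set F) (s : seq F).

Lemma is_trdeg_rank X Y n :
  is_trdeg (gen_field (X `|` Y)) (gen_field Y) n -> rank_spec (@acl F) Y X n.
Proof.
move=> [t [Xt It Lt]]; exists t; split; first exact: size_tuple.
- apply: (eq_indep (acl_pregeometry F) (acl_gen Y)).
  apply/(alg_independent_indep (gen_field_subfield Y)).
  exact: alg_independent_cast It.
- by move=> x /= /tnthP[i ->]; rewrite setUC; exact: (gen_field_sub_acl (Xt i)).
- rewrite -acl_genU => x Xx; apply: Lt; apply: sub_gen_field; left; exact: Xx.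
Qed.

(** A basis extracted from the finite list [s] is a transcendence basis, so [xget] does not fall
    back on its default value 0. *)
Lemma td_rank s Y : rank_spec (@acl F) Y [set` s] (td [set` s] Y).
Proof.
rewrite /td; case: xgetP => [n _ /is_trdeg_rank //|none].
have [t [It ts st]] := basis_exists (acl_pregeometry F) Y s.
case: (none (size t)); exists (in_tuple t); split.
- by move=> i; apply: sub_gen_field; left; apply/ts/mem_tnth.
- apply/(alg_independent_indep (gen_field_subfield Y)).
  exact: (eq_indep (acl_pregeometry F) (esym (acl_gen Y))).
- rewrite -[algebraic_over _]/(acl _) acl_genU; apply: gen_field_sub.
    exact: acl_subfield.
  by move=> x [/st|Yx] //; apply: sub_acl; left.
Qed.

Hypothesis char0 : [pchar F] =i pred0.

Lemma is_qdim_rank X Y n :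
  is_qdim (qspan (X `|` Y)) (qspan Y) n -> rank_spec (@qspan F) Y X n.
Proof.
move=> [t [Xt It Lt]]; exists t; split; first exact: size_tuple.
- exact/indep_qspan_tuple.
- by move=> x /= /tnthP[i ->]; rewrite setUC; apply: Xt.
- by move=> x Xx; apply/qspan_tuple => //; apply: Lt; apply: sub_qspan; left.
Qed.

Lemma ldim_rank s Y : rank_spec (@qspan F) Y [set` s] (ldim [set` s] Y).
Proof.
rewrite /ldim; case: xgetP => [n _ /is_qdim_rank //|none].
have [t [It ts st]] := basis_exists (qspan_pregeometry char0) Y s.
case: (none (size t)); exists (in_tuple t); split.
- by move=> i; apply: sub_qspan; left; apply/ts/mem_tnth.
- exact/indep_qspan_tuple.
- move=> x Xx; apply/qspan_tuple => //; move: x Xx; apply: qspan_qspan.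
  by move=> x [/st|Yx] //; apply: sub_qspan; left.
Qed.

End Ranks.

(** * Exponential fields *)

Section Exponential.
Variable F : pEfield.
Local Notation exp := (@pe_exp F).
Local Notation D := (pe_dom F).
Let char0 := @pe_char0 F.
Let QD : qsubspace D := pe_dom_qsubspace F.

Lemma pe_exp0 : exp 0 = 1.
Proof.
have D0 : D 0 := QD.1; apply: (mulfI (pe_exp_neq0 D0)).
by rewrite -pe_expD // addr0 mulr1.
Qed.

Lemma pe_expN x : D x -> exp (- x) = (exp x)^-1.
Proof.
move=> Dx; apply: (mulIf (pe_exp_neq0 Dx)).
by rewrite mulVf ?pe_exp_neq0 // -pe_expD ?addNr ?pe_exp0 //; apply: qsubspaceN.
Qed.

Lemma pe_expMn x n : D x -> exp (x *+ n) = exp x ^+ n.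
Proof.
move=> Dx; elim: n => [|n IHn]; first by rewrite pe_exp0.
by rewrite mulrS pe_expD ?IHn ?exprS //; apply: qsubspaceMn.
Qed.

Lemma acl_expr_root (A : set F) x n : (0 < n)%N -> acl A (x ^+ n) -> acl A x.
Proof.
move=> n0 Ax; apply: (@acl_root _ _ ('X^n - (x ^+ n)%:P)).
- by rewrite -size_poly_eq0 size_XnsubC.
- move=> i; apply/(sf_predP (acl_subfield A)).
  rewrite coefB coefXn coefC rpredB ?rpred_nat //.
  by case: eqP => _; [apply/sf_predP | apply: rpred0].
- by rewrite /root !hornerE subrr.
Qed.

(** For closure under rational multiples: a positive integral power of [exp (ratr q * x)] is an
    integral power of [exp x], and [acl] is closed under roots. *)
Lemma exp_acl_qsubspace (A : set F) : qsubspace [set x | D x /\ acl A (exp x)].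
Proof.
have SA := acl_subfield A.
split=> [|q x y [Dx Ax] [Dy Ay]].
  by split; [exact: QD.1 | rewrite pe_exp0; apply/(sf_predP SA)/rpred1].
have Dqx := qsubspaceZ QD q Dx; split; first exact: QD.2.
rewrite pe_expD //; apply/(sf_predP SA)/rpredM; last exact/sf_predP.
(* The exponent is the denominator of [q], which turns the rational multiple into the multiple of
   [x] by the numerator. *)
apply/sf_predP/(@acl_expr_root _ _ `|denq q|%N); first by rewrite absz_gt0 denq_eq0.
rewrite -pe_expMn // -mulr_natl.
have d0 : (denq q)%:~R != 0 :> F by rewrite pchar0_intr_eq0 ?denq_eq0.
have -> : (`|denq q|%N)%:R * (ratr q * x) = (numq q)%:~R * x :> F.
  by rewrite pmulrn absz_denq /ratr mulrA mulrCA divff // mulr1.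
apply/(sf_predP SA); case: (numq q) => n; rewrite ?NegzE ?mulrNz ?mulNr -pmulrn mulr_natl.
  by rewrite pe_expMn // rpredX //; apply/sf_predP.
rewrite pe_expN ?pe_expMn ?rpredV ?rpredX //; first exact/sf_predP.
exact: qsubspaceMn.
Qed.

(** Replacing a base by its rational span does not change the transcendence degrees over it and its
    exponentials. *)
Lemma acl_qspan_exp (A : set F) : A `<=` D ->
  acl (qspan A `|` exp @` qspan A) = acl (A `|` exp @` A).
Proof.
move=> AD.
have Aacl : A `<=` acl (A `|` exp @` A) by move=> x Ax; apply: sub_acl; left.
apply/seteqP; split; apply: acl_sub => x [Ax|[y Ay <-]].
- apply: qspan_sub Ax => //; exact: subfield_qsubspace (acl_subfield _).
- suff [] : [set x | D x /\ acl (A `|` exp @` A) (exp x)] y by [].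
  apply: qspan_sub Ay; first exact: exp_acl_qsubspace.
  by move=> z Az; split; [exact: AD | apply: sub_acl; right; exists z].
- by apply: sub_acl; left; apply: sub_qspan.
- by apply: sub_acl; right; exists y => //; apply: sub_qspan.
Qed.

Lemma image_set_seq (s : seq F) : exp @` [set` s] = [set` map exp s].
Proof.
by apply/seteqP; split=> [_ [x xs <-]|_ /mapP[x xs ->]]; [apply: map_f | exists x].
Qed.

(** Additivity of both ranks gives that of their difference. The base on the right is a rational
    span because the domain of a generated partial E-subfield is one. *)
Lemma delta_cat (x a : seq F) B : B `<=` D -> [set` a] `<=` D ->
  delta (x ++ a) B = delta x (qspan (B `|` [set` a])) + delta a B.
Proof.
move=> BD aD; pose e (s : seq F) := s ++ map exp s.
have eE s : [set` s] `|` exp @` [set` s] = [set` e s].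
  by rewrite image_set_seq -set_cat_setU.
have ldimD : ldim [set` x ++ a] B =
    (ldim [set` x] (qspan (B `|` [set` a])) + ldim [set` a] B)%N.
  have pgQ := qspan_pregeometry char0.
  (* [ldim], like [td] below, is chosen by [xget], so an equation between values follows from
     uniqueness of the rank. *)
  apply: (rank_uniq pgQ (ldim_rank char0 (x ++ a) B)).
  rewrite set_cat_setU; apply: (rank_add pgQ); first exact: ldim_rank.
  by apply: (eq_rank pgQ (qspan_id _)); apply: ldim_rank.
have tdD : td [set` e (x ++ a)] (B `|` exp @` B) =
    (td [set` e x] (qspan (B `|` [set` a]) `|` exp @` qspan (B `|` [set` a]))
     + td [set` e a] (B `|` exp @` B))%N.
  have pgA := acl_pregeometry F.
  apply: (rank_uniq pgA (td_rank (e (x ++ a)) (B `|` exp @` B))).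
  rewrite -eE set_cat_setU image_setU setUACA !eE.
  apply: (rank_add pgA); first exact: td_rank.
  apply: (eq_rank pgA) (td_rank _ _); rewrite acl_qspan_exp.
    by rewrite image_setU setUACA eE.
  by move=> z [/BD|/aD].
by rewrite /delta !eE tdD ldimD !PoszD opprD addrACA.
Qed.

Lemma sub_incl_dom (S : subpE F) : sub_incl S @` pe_dom (sub_pEfield S) = sp_dom S.
Proof.
apply/seteqP; split=> [_ [x Dx <-] //|x Dx].
by exists (exist _ x (mem_set (sp_dom_sub Dx))).
Qed.

Lemma sub_incl_range (S : subpE F) : range (sub_incl S) = sp_set S.
Proof.
apply/seteqP; split=> [_ [x _ <-]|x Sx]; first exact/set_mem/(valP x).
by exists (exist _ x (mem_set Sx)).
Qed.

Lemma ELA_gen_mono (A B : set F) : A `<=` B -> ELA_gen A `<=` ELA_gen B.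
Proof. by move=> AB x Ax C [EC BC]; apply: Ax; split=> // y /AB/BC. Qed.

End Exponential.

(** * Strong hulls and finite presentation *)

Lemma pEhom_corestrict (F F1 : pEfield) (i : pEhom F F1) (S : subpE F1) :
    range i `<=` sp_set S -> i @` pe_dom F `<=` sp_dom S ->
  exists h : pEhom F (sub_pEfield S), forall x, sub_incl S (h x) = i x.
Proof.
move=> iS iD.
have Si x : sp_pred S (i x) by apply/mem_set/iS; exists x.
pose h x : sp_type S := exist _ (i x) (Si x).
have hB : zmod_morphism h by move=> x y; apply: val_inj; rewrite /= !rmorphB.
have hM : monoid_morphism h.
  by split=> [|x y]; apply: val_inj; rewrite /= ?rmorph1 ?rmorphM.
pose hR : {rmorphism F -> sp_type S} := HB.pack h
  (GRing.isZmodMorphism.Build F (sp_type S) h hB)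
  (GRing.isMonoidMorphism.Build F (sp_type S) h hM).
have hD x : pe_dom F x -> pe_dom (sub_pEfield S) (hR x).
  by move=> Dx; apply: iD; exists x.
have hE x : pe_dom F x ->
    pe_exp (hR x : sub_pEfield S) = hR (pe_exp x) :> sub_pEfield S.
  (* Compatibility with the exponential can be checked in [F1], where it is that of [i]. *)
  move=> Dx; apply: (fmorph_inj (sub_incl S)).
  by rewrite -(pe_hom_exp (sub_incl S) (hD x Dx)); exact: (pe_hom_exp i Dx).
by exists (@PEHom F (sub_pEfield S) hR hD hE).
Qed.

Lemma isomorphic_over_refl (K L : pEfield) (j : pEhom K L) : isomorphic_over j j.
Proof.
pose f : pEhom L L := @PEHom L L idfun (fun x Dx => Dx) (fun x _ => erefl).
by exists f, f.
Qed.

Lemma strong_hull (F F1 : pEfield) (i : pEhom F F1) (s : seq F1) :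
    pe_dom F1 = setT -> strong i ->
  exists2 a : seq F1, [set` s] `<=` [set` a] &
    forall x : seq F1, 0 <= delta x (qspan (i @` pe_dom F `|` [set` a])).
Proof.
move=> DF1 strong_i; set B := i @` pe_dom F.
have subD (A : set F1) : A `<=` pe_dom F1 by rewrite DF1.
(* Strongness makes every value of [delta] over [B] a natural number, so a least value is attained
   among the tuples containing [s]. *)
pose P n := `[< exists2 a : seq F1, [set` s] `<=` [set` a] & delta a B = n%:Z >].
have exP : exists n, P n.
  exists `|delta s B|%N; apply/asboolP; exists s => //.
  by rewrite gez0_abs //; apply: strong_i.
case: (ex_minnP exP) => n /asboolP[a sa def_n] min_n; exists a => // x.
(* The tuple [x ++ a] still contains [s], so its [delta] is at least the minimum attained by [a];
   additivity turns this into the claim. *)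
have: (n <= `|delta (x ++ a) B|)%N.
  apply: min_n; apply/asboolP; exists (x ++ a).
    by move=> y /sa /= ya; rewrite mem_cat ya orbT.
  by rewrite gez0_abs //; apply: strong_i.
rewrite -lez_nat gez0_abs; last exact: strong_i.
by rewrite delta_cat // def_n lerDr.
Qed.

Theorem theorem3p11 (F F1 : pEfield) (i : pEhom F F1)
    (ELA_F : is_ELA F) (ELA_F1 : is_ELA F1)
    (countable_F : countable [set: F]%classic)
    (countable_F1 : countable [set: F1]%classic)
    (fg_i : finitely_generated i)
    (kernel_i : kernel_preserving i)
    (strong_i : strong i) :
  finitely_presented i.
Proof.
have [DF _ _] := ELA_F; have [DF1 _ _] := ELA_F1.
have [_ /finite_seqP[s ->] gen_s] := fg_i.
have [a sa strong_a] := strong_hull s DF1 strong_i.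
have gen_a : ELA_gen (range i `|` [set` a]) = setT.
  by rewrite -subTset -gen_s; apply: ELA_gen_mono; apply: setUS.
exists a => //= ; set S := pe_gen _.
have domS : sp_dom S = qspan (range i `|` [set` a]).
  by rewrite /= /pe_gen_dom DF1 setTI.
have iS : range i `<=` sp_set S by move=> x ix; apply: sub_gen_field; right; left.
have iD : i @` pe_dom F `<=` sp_dom S.
  by rewrite domS DF => x ix; apply: sub_qspan; left.
have [h hE] := pEhom_corestrict iS iD.
have kernel_h : kernel_preserving h.
  apply/seteqP; split=> [x [Dx ex]|_ [x [Dx ex] <-]]; last first.
    by split; [apply: pe_hom_dom | rewrite pe_hom_exp // ex rmorph1].
  (* An element of the kernel of the subfield is in the kernel of [F1], hence comes from the kernel
     of [F]. *)
  have : kernel F1 (sub_incl S x).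
    by split; [apply: pe_hom_dom | rewrite pe_hom_exp // ex rmorph1].
  rewrite kernel_i => -[y ky iy]; exists y => //.
  by apply: (fmorph_inj (sub_incl S)); rewrite hE.
split; first by exists h.
(* [F1] itself serves as the free extension, with the identity as isomorphism. *)
exists F1, (sub_incl S); split; last exact: isomorphic_over_refl.
split=> //.
- rewrite /kernel_preserving kernel_h kernel_i.
  apply/seteqP; split=> [_ [x kx <-]|_ [_ [x kx <-] <-]]; last by exists x.
  by exists (h x); [exists x | exact: hE].
(* The domain of the subfield is exactly the span over which [strong_hull] makes [delta]
   non-negative. *)
- by move=> x _; rewrite sub_incl_dom domS -DF; apply: strong_a.
- rewrite -subTset -gen_a sub_incl_range; apply: ELA_gen_mono => x Xx.
  by apply: sub_gen_field; right.
Qed.
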